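(* Let $m=m_n\ge 1$ and $d=d_n$ be integers with $2\le d\le n$, and let $H^*_{nmd}$ be the random hypergraph on node set $\{1,\dots,n\}$ whose hyperedge set is $\{V_1,\dots,V_m\}$, where $V_1,\dots,V_m$ are mutually independent uniformly random $d$-element subsets of $\{1,\dots,n\}$. Then, as $n\to\infty$, \[ \mathbb{P}(H^*_{nmd} \text{ is connected}) \to \begin{cases} 0 & \text{if } \log n + m\log(1-d/n) \to +\infty,\\ 1 & \text{if } \log n + m\log(1-d/n) \to -\infty.\end{cases} \]
   Context: A hypergraph on node set $V$ is connected if for every partition of $V$ into nonempty sets $V_1',V_2'$ some hyperedge meets both. Convention $\log 0=-\infty$. *)

(* Defs.v *)
From HB Require Import structures.
From mathcomp Require Import all_boot all_order all_algebra.
From mathcomp Require Import all_classical all_reals all_analysis.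
Set Implicit Arguments. Unset Strict Implicit. Unset Printing Implicit Defensive.
Import Order.TTheory GRing.Theory Num.Theory.
Local Open Scope ring_scope.

Definition hconnected (n m : nat) (E : 'I_m -> {set 'I_n}) : bool :=
  [forall S : {set 'I_n},
     ((S != finset.set0) && (~: S != finset.set0)) ==>
     [exists i : 'I_m, (E i :&: S != finset.set0) && (E i :&: ~: S != finset.set0)]].

Definition dsubset (n d : nat) := {A : {set 'I_n} | #|A| == d}.

(* Sample space of H*_{nmd}: m independent uniform d-subsets, i.e. the
   uniform distribution on 'I_m -> d-subsets. *)
Definition hyp_of (n m d : nat) (f : {ffun 'I_m -> dsubset n d}) :
  'I_m -> {set 'I_n} := fun i => val (f i).

Definition prob_connected (R : realType) (n m d : nat) : R :=
  (#|[set f : {ffun 'I_m -> dsubset n d} | hconnected (hyp_of f)]|%:R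
   / #|{ffun 'I_m -> dsubset n d}|%:R).

(* log n + m log(1 - d/n) as an extended real, with log 0 = -oo
   (the case d = n). *)
Definition conn_quantity (R : realType) (n m d : nat) : \bar R :=
  if (d < n)%N then
    ((ln (n%:R : R) + m%:R * ln (1 - d%:R / n%:R))%:E)%E
  else (-oo)%E.

(* Main.v *)
Require Import Defs.
From HB Require Import structures.
From mathcomp Require Import all_boot all_order all_algebra.
From mathcomp Require Import all_classical all_reals all_analysis.
From mathcomp Require Import ring lra zify.
Set Implicit Arguments. Unset Strict Implicit. Unset Printing Implicit Defensive.
Import Order.TTheory GRing.Theory Num.Theory.
Import numFieldNormedType.Exports.
Local Open Scope ring_scope.

(* Put x = s/n and Q = ln n + m ln(1 - d/n), so that the expected number of
   isolated nodes is e^Q. If Q -> +oo, Chebyshev's inequality gives an isolated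
   node with high probability. If Q -> -oo, take the union bound over the node
   sets S with 1 <= s = |S| <= n/2 that no hyperedge crosses: each hyperedge
   fails to cross S with probability at most (1 - d/n)^s when s < d, and at most
   x^d + (1 - x)^d <= exp(- d x (1 - x)) when s >= d; in both cases the
   'C(n, s) sets of size s contribute at most exp(s (3 + Q/4)), which leaves a
   geometric series of ratio exp(3 + Q/4) -> 0. *)

(** * Ratios of binomial coefficients *)

Lemma leq_bin_subn (n d s : nat) :
  ('C(n - s, d) * n ^ s <= 'C(n, d) * (n - d) ^ s)%N.
Proof.
elim: s => [|s IHs]; first by rewrite subn0.
(* After multiplying by n - s, absorption reduces this to (n - s - d) n <= (n - s)(n - d). *)
have step : ('C(n - s.+1, d) * n <= 'C(n - s, d) * (n - d))%N.
  rewrite subnS; have [->|N0] := posnP (n - s)%N.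
    by case: d {IHs} => [|d]; rewrite ?bin0 ?subn0 //= bin0n.
  rewrite -(leq_pmul2l N0) mulnA mul_bin_down mulnAC [leqRHS]mulnCA mulnC.
  by rewrite leq_mul2l; apply/orP; right; nia.
rewrite !expnS mulnA (leq_trans (leq_mul step (leqnn _))) //.
by rewrite mulnAC [leqRHS]mulnCA [leqRHS]mulnC leq_mul.
Qed.

(** The ratio 'C(a, d) / 'C(n, d) is a product of d factors (a - i) / (n - i), each at most a /
    n. *)
Lemma leq_bin_pow (a n d : nat) : (a <= n)%N ->
  ('C(a, d) * n ^ d <= 'C(n, d) * a ^ d)%N.
Proof.
move=> le_an; elim: d => [|d IHd]; first by rewrite !bin0.
rewrite -(leq_pmul2l (ltn0Sn d)) !mulnA !mul_bin_left !expnS.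
have step : ((a - d) * n <= (n - d) * a)%N by nia.
have := leq_mul step IHd; lia.
Qed.

(** * Counting hypergraphs with no edge across a cut *)

Lemma card_dsubset (n d : nat) : #|{: dsubset n d}| = 'C(n, d).
Proof. rewrite card_sig -[in RHS](card_ord n) -card_draws. by rewrite cardsE. Qed.

Lemma card_dsubset_sub (n d : nat) (B : {set 'I_n}) :
  #|[set A : dsubset n d | val A \subset B]| = 'C(#|B|, d).
Proof.
rewrite -cards_draws -(card_imset _ val_inj); apply: eq_card => A.
apply/imsetP/idP => [[A' /[!inE] sAB ->]|/[!inE] /andP[sAB cA]].
  by rewrite sAB; exact: (valP A').
by exists (exist _ A cA); rewrite ?inE.
Qed.

Lemma card_ffun_forall (m : nat) (T : finType) (P : {set T}) :
  #|[set f : {ffun 'I_m -> T} | [forall i, f i \in P]]| = (#|P| ^ m)%N.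
Proof.
rewrite -[in RHS](card_ord m) -card_ffun_on cardsE; apply: eq_card => f.
by rewrite !inE; apply/forallP/ffun_onP.
Qed.

Definition crosses (n : nat) (A S : {set 'I_n}) : bool :=
  (A :&: S != finset.set0) && (A :&: ~: S != finset.set0).

Lemma crossesC (n : nat) (A S : {set 'I_n}) : crosses A (~: S) = crosses A S.
Proof. by rewrite /crosses finset.setCK andbC. Qed.

Lemma crossesN (n : nat) (A S : {set 'I_n}) :
  ~~ crosses A S = (A \subset S) || (A \subset ~: S).
Proof.
rewrite /crosses negb_and !negbK orbC -!finset.setD_eq0 !finset.setDE.
by rewrite finset.setCK.
Qed.

Lemma card_noncrossing (n m d : nat) (S : {set 'I_n}) :
  (#|[set f : {ffun 'I_m -> dsubset n d} | [forall i, ~~ crosses (val (f i)) S]]|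
   <= ('C(#|S|, d) + 'C(n - #|S|, d)) ^ m)%N.
Proof.
pose P := [set A : dsubset n d | ~~ crosses (val A) S].
rewrite (_ : [set f : {ffun 'I_m -> dsubset n d} | _]
           = [set f : {ffun 'I_m -> dsubset n d} | [forall i, f i \in P]]); last first.
  by apply/setP => f; rewrite !inE; apply: eq_forallb => i; rewrite inE.
rewrite card_ffun_forall.
have -> : (n - #|S| = #|~: S|)%N by rewrite [in RHS]cardsCs finset.setCK card_ord.
rewrite -!card_dsubset_sub; case: m => [//|m]; rewrite leq_exp2r //.
apply: leq_trans (leq_of_leqif (leq_card_setU _ _)); apply/subset_leq_card/fintype.subsetP => A.
by rewrite !inE crossesN.
Qed.

(** Crossing is invariant under complement, so a disconnected hypergraph has an uncrossed set of
    size between 1 and n/2. The union bound is then grouped by size. *)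
Lemma disconnected_card_le (n m d : nat) :
  (#|[set f : {ffun 'I_m -> dsubset n d} | ~~ hconnected (hyp_of f)]|
   <= \sum_(s < n./2.+1 | 0 < s)
        'C(n, s) * ('C(s, d) + 'C(n - s, d)) ^ m)%N.
Proof.
pose D (S : {set 'I_n}) (f : {ffun 'I_m -> dsubset n d}) :=
  [forall i, ~~ crosses (val (f i)) S].
pose small (S : {set 'I_n}) := (0 < #|S| <= n./2)%N.
have H f : ~~ hconnected (hyp_of f) -> exists2 S, small S & D S f.
  rewrite negb_forall => /existsP[S]; rewrite negb_imply => /andP[].
  move=> /andP[S0 SC0]; rewrite negb_exists => SD.
  have cS := cardsC S; rewrite card_ord in cS.
  rewrite -card_gt0 in S0; rewrite -card_gt0 in SC0.
  have [le_S|lt_S] := leqP #|S| n./2.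
    by exists S; rewrite // /small S0.
  exists (~: S); first by rewrite /small SC0 -(leq_add2l #|S|) cS;
    move: lt_S; move: #|S| => a; lia.
  by apply/forallP => i; rewrite crossesC; exact: (forallP SD i).
apply: (@leq_trans (\sum_(S | small S) #|[set f | D S f]|)).
  (* Exchanging the sums, each disconnected [f] is counted at least once, by its own witness [S]. *)
  under eq_bigr do rewrite -sum1dep_card big_mkcond /=.
  rewrite exchange_big -sum1dep_card big_mkcond /=; apply: leq_sum => f _.
  case: ifPn => // /H[S sS DS]; rewrite (bigD1 S) //= DS; exact: leq_addr.
pose g s := (('C(s, d) + 'C(n - s, d)) ^ m)%N.
apply: (@leq_trans (\sum_(S | small S) g #|S|)).
  by apply: leq_sum => S _; exact: card_noncrossing.
rewrite (partition_big (fun S : {set 'I_n} => inord #|S| : 'I_n./2.+1)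
  (fun s => 0 < s)%N) /=.
  apply: leq_sum => s s0.
  rewrite (eq_bigr (fun=> g s)) ?sum_nat_const => [|S /andP[/andP[_ sS] /eqP <-]].
    rewrite leq_mul2r -[in X in 'C(X, _)](card_ord n) -card_draws.
    apply/orP; right; apply/subset_leq_card/fintype.subsetP => S /andP[/andP[_ sS] /eqP <-].
    by rewrite inE inordK.
  by rewrite inordK.
by move=> S /andP[S0 sS]; rewrite inordK.
Qed.

(** * Total counts, and the probability of avoiding given nodes *)

Lemma card_hypergraphs (n m d : nat) :
  #|{: {ffun 'I_m -> dsubset n d}}| = ('C(n, d) ^ m)%N.
Proof. by rewrite card_ffun card_dsubset card_ord. Qed.

Lemma card_hypergraphs_sub (n m d : nat) (B : {set 'I_n}) :
  #|[set f : {ffun 'I_m -> dsubset n d} | [forall i, val (f i) \subset B]]|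
  = ('C(#|B|, d) ^ m)%N.
Proof.
rewrite -card_dsubset_sub -card_ffun_forall; apply: eq_card => f.
by rewrite !inE; apply: eq_forallb => i; rewrite inE.
Qed.

Lemma ler_bin_subn (R : realFieldType) (n d s : nat) : (0 < n)%N -> (d <= n)%N ->
  'C(n - s, d)%:R <= 'C(n, d)%:R * (1 - d%:R / n%:R) ^+ s :> R.
Proof.
move=> n0 le_dn; have nR : 0 < n%:R :> R by rewrite ltr0n.
have -> : 1 - d%:R / n%:R = (n - d)%:R / n%:R :> R.
  by rewrite natrB // mulrBl divff ?gt_eqF.
rewrite expr_div_n mulrA ler_pdivlMr ?exprn_gt0 //.
by rewrite -!natrX -!natrM ler_nat leq_bin_subn.
Qed.

(** For a single node the bound of [ler_bin_subn] is exact. Equality matters: the mean enters the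
    variance with a negative sign. *)
Lemma bin_pred_ratio (R : realFieldType) (n d : nat) : (0 < n)%N -> (d <= n)%N ->
  'C(n.-1, d)%:R = 'C(n, d)%:R * (1 - d%:R / n%:R) :> R.
Proof.
move=> n0 le_dn; have nR : n%:R != 0 :> R by rewrite pnatr_eq0 -lt0n.
apply: (mulfI nR); rewrite -natrM mul_bin_down natrM natrB //.
by field.
Qed.

(** * Second moment of the number of isolated nodes *)

Definition isolated (n m d : nat) (f : {ffun 'I_m -> dsubset n d}) (v : 'I_n) :=
  [forall i, v \notin val (f i)].

Lemma hconnected_isolated (n m d : nat) (f : {ffun 'I_m -> dsubset n d}) v :
  (1 < n)%N -> hconnected (hyp_of f) -> ~~ isolated f v.
Proof.
move=> n1 /forallP/(_ [set v]).
have -> : [set v] != finset.set0 by rewrite -card_gt0 cards1.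
have -> : ~: [set v] != finset.set0.
  by rewrite -card_gt0 finset.cardsC1 card_ord; case: n n1 f v => [|[]].
move=> /existsP[i /andP[/finset.set0Pn[w /[!inE] /andP[wi /eqP wv]] _]].
by rewrite negb_forall; apply/existsP; exists i; rewrite negbK -wv.
Qed.

Lemma isolated_card (n m d : nat) (v : 'I_n) :
  #|[set f : {ffun 'I_m -> dsubset n d} | isolated f v]| = ('C(n.-1, d) ^ m)%N.
Proof.
rewrite -[in RHS](card_ord n) -(finset.cardsC1 v) -card_hypergraphs_sub.
apply: eq_card => f; rewrite !inE; apply: eq_forallb => i.
by rewrite finset.subsetC finset.sub1set inE.
Qed.

Lemma isolated2_card (n m d : nat) (v w : 'I_n) : v != w ->
  #|[set f : {ffun 'I_m -> dsubset n d} | isolated f v && isolated f w]|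
  = ('C(n - 2, d) ^ m)%N.
Proof.
move=> vw; have -> : (n - 2 = #|~: [set v; w]|)%N.
  by rewrite [in RHS]cardsCs finset.setCK cards2 vw card_ord.
rewrite -card_hypergraphs_sub; apply: eq_card => f; rewrite !inE.
apply/andP/forallP => [[/forallP fv /forallP fw] i|fvw].
  by rewrite finset.subsetC finset.subUset !finset.sub1set !inE fv fw.
split; apply/forallP => i; move: (fvw i);
  by rewrite finset.subsetC finset.subUset !finset.sub1set !inE => /andP[].
Qed.

(* Chebyshev's inequality for the number X of isolated nodes, whose mean is mu:
   pairs of distinct nodes are negatively correlated, so Var X <= mu. *)
Lemma prob_connected_le (R : realType) (n m d : nat) : (1 < n)%N -> (d < n)%N ->
  prob_connected R n m d <= (n%:R * (1 - d%:R / n%:R) ^+ m)^-1.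
Proof.
move=> n1 lt_dn; set p : R := 1 - _; set mu := n%:R * _.
have n0 : (0 < n)%N by lia.
have p0 : 0 < p by rewrite subr_gt0 ltr_pdivrMr ?ltr0n // mul1r ltr_nat.
have mu0 : 0 < mu by rewrite mulr_gt0 ?exprn_gt0 // ltr0n.
rewrite /prob_connected card_hypergraphs.
set N0 := #|_|; set N : R := (_ ^ _)%:R.
have N_gt0 : 0 < N by rewrite ltr0n expn_gt0 bin_gt0 ltnW.
pose X (f : {ffun 'I_m -> dsubset n d}) : R := \sum_v (isolated f v)%:R.
have sumE (P : pred {ffun 'I_m -> dsubset n d}) :
    \sum_f (P f)%:R = #|[set f | P f]|%:R :> R.
  rewrite -sum1dep_card natr_sum [RHS]big_mkcond.
  by apply: eq_bigr => f _; case: (P f).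
have EX : \sum_f X f = N * mu.
  rewrite exchange_big /= (eq_bigr (fun=> N * p ^+ m)) => [|v _].
    by rewrite sumr_const card_ord -mulr_natl mulrCA.
  rewrite sumE isolated_card natrX bin_pred_ratio 1?ltnW //.
  by rewrite exprMn /N natrX.
(* Expand over ordered pairs of nodes. The diagonal gives N mu; the n - 1 off-diagonal terms of each
   row are at most N p^(2m), and n such terms are allowed for. *)
have EX2 : \sum_f X f ^+ 2 <= N * (mu + mu ^+ 2).
  under eq_bigr do rewrite expr2 mulr_suml.
  rewrite exchange_big /= mulrDr.
  have -> : N * mu + N * mu ^+ 2
            = \sum_(v < n) (N * p ^+ m + n%:R * (N * p ^+ m ^+ 2)).
    by rewrite sumr_const card_ord -[RHS]mulr_natl /mu; ring.
  apply: ler_sum => v _; under eq_bigr do rewrite mulr_sumr.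
  rewrite exchange_big /= (bigD1 v) //= lerD //.
    under eq_bigr do rewrite -natrM mulnb andbb.
    rewrite sumE isolated_card natrX bin_pred_ratio 1?ltnW //.
    by rewrite exprMn /N natrX.
  rewrite -[n in n%:R]card_ord mulr_natl -sumr_const [leRHS](bigD1 v) //=.
  have pos : 0 <= N * p ^+ m ^+ 2 by rewrite mulr_ge0 ?exprn_ge0 // ltW.
  rewrite -[leLHS]add0r lerD //; apply: ler_sum => w wv.
  under eq_bigr do rewrite -natrM mulnb.
  rewrite sumE isolated2_card 1?eq_sym // natrX /N natrX -exprM mulnC exprM.
  rewrite -exprMn lerXn2r ?nnegrE ?ler0n //.
    by rewrite mulr_ge0 ?exprn_ge0 // ltW.
  by rewrite ler_bin_subn // ltnW.
(* A connected hypergraph has X = 0, so it contributes exactly mu^2. *)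
have cheb : N0%:R * mu ^+ 2 <= \sum_f (X f - mu) ^+ 2.
  rewrite /N0 -sumE mulr_suml; apply: ler_sum => f _.
  have [cf|_] := boolP (hconnected _); last by rewrite mul0r sqr_ge0.
  rewrite /X big1 ?sub0r ?sqrrN ?mul1r // => v _.
  by rewrite (negbTE (hconnected_isolated _ n1 cf)).
have varE : \sum_f (X f - mu) ^+ 2
            = \sum_f X f ^+ 2 - 2 * mu * \sum_f X f + N * mu ^+ 2.
  rewrite mulr_sumr -sumrB.
  have -> : N * mu ^+ 2 = \sum_(f : {ffun 'I_m -> dsubset n d}) mu ^+ 2.
    by rewrite sumr_const card_hypergraphs mulr_natl.
  by rewrite -big_split /=; apply: eq_bigr => f _; ring.
have {cheb varE} : N0%:R * mu ^+ 2 <= N * mu.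
  by rewrite (le_trans cheb) // varE EX; move: EX2; lra.
rewrite expr2 mulrA ler_pM2r // => h.
by rewrite ler_pdivrMr // mulrC ler_pdivlMr.
Qed.

(** * Analytic estimates for the union bound *)

Lemma ffact_leq_expn (n s : nat) : (n ^_ s <= n ^ s)%N.
Proof.
by elim: s => // s IHs; rewrite ffactnSr expnSr leq_mul // leq_subr.
Qed.

(** The l^d norm of (a, b) is at most its l^2 norm; this form avoids fractional powers. The
    induction step is Cauchy-Schwarz with the extra nonnegative term in u v. *)
Lemma sqr_sum_pow_le (R : realFieldType) (a b : R) (d : nat) :
  0 <= a -> 0 <= b -> (2 <= d)%N ->
  (a ^+ d + b ^+ d) ^+ 2 <= (a ^+ 2 + b ^+ 2) ^+ d.
Proof.
move=> a0 b0; elim: d => // d IHd; rewrite leq_eqVlt => /predU1P[[<-] //|d2].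
have := IHd d2; have := exprn_ge0 d a0; have := exprn_ge0 d b0.
rewrite (exprS a d) (exprS b d) (exprS _ d); set u := a ^+ d; set v := b ^+ d => v0 u0 IH.
apply: (@le_trans _ _ ((a ^+ 2 + b ^+ 2) * (u + v) ^+ 2)); last first.
  by rewrite ler_wpM2l // addr_ge0 ?sqr_ge0.
rewrite -subr_ge0.
have -> : (a ^+ 2 + b ^+ 2) * (u + v) ^+ 2 - (a * u + b * v) ^+ 2
  = (a * v - b * u) ^+ 2 + 2 * (a ^+ 2 + b ^+ 2) * (u * v) by ring.
by rewrite addr_ge0 ?sqr_ge0 // !mulr_ge0 ?addr_ge0 ?sqr_ge0.
Qed.

(** A weak Stirling bound; the induction step rests on (1 + 1/s)^s <= e. *)
Lemma exp_fact_ge (R : realType) (s : nat) : s%:R ^+ s <= s`!%:R * expR s%:R :> R.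
Proof.
elim: s => [|s IHs]; first by rewrite expr0 fact0 mul1r expR0.
rewrite exprS factS natrM -mulrA ler_wpM2l //.
have [->|s0] := posnP s; first by rewrite expr0 fact0 mul1r -expR0 ler_expR.
have sR : 0 < s%:R :> R by rewrite ltr0n.
have -> : s.+1%:R ^+ s = s%:R ^+ s * (1 + s%:R^-1) ^+ s :> R.
  by rewrite -exprMn mulrDr mulr1 divff ?gt_eqF // natr1.
have h : (1 + s%:R^-1) ^+ s <= expR 1 :> R.
  apply: (@le_trans _ _ (expR s%:R^-1 ^+ s)).
    by rewrite lerXn2r ?nnegrE ?expR_ge0 ?expR_ge1Dx // addr_ge0 // invr_ge0 ltW.
  by rewrite -expRM_natl divff ?gt_eqF.
rewrite -[s.+1%:R]natr1 expRD mulrA ler_pM ?exprn_ge0 ?addr_ge0 ?invr_ge0 //.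
Qed.

(** This is the bound (e n / s)^s, from n^s / s! and [exp_fact_ge], written so that its exponent can
    be added to that of the edges. *)
Lemma bin_le_expR (R : realType) (n s : nat) : (0 < s)%N -> (0 < n)%N ->
  'C(n, s)%:R <= expR (s%:R * (1 + ln n%:R - ln s%:R)) :> R.
Proof.
move=> s0 n0; have sR : 0 < s%:R :> R by rewrite ltr0n.
have nR : 0 < n%:R :> R by rewrite ltr0n.
rewrite mulrBr mulrDr mulr1 expRB expRD !expRM_natl !lnK ?posrE //.
rewrite ler_pdivlMr ?exprn_gt0 //.
rewrite (le_trans (ler_wpM2l _ (exp_fact_ge R s))) //.
rewrite mulrA mulrC ler_wpM2l ?expR_ge0 // -natrM bin_ffact -natrX ler_nat.
exact: ffact_leq_expn.
Qed.

(** An edge larger than S cannot lie inside it, so it fails to cross only by avoiding S. *)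
Lemma noncrossing_lt (R : realFieldType) (n d s : nat) :
  (0 < n)%N -> (d <= n)%N -> (s < d)%N ->
  ('C(s, d) + 'C(n - s, d))%:R <= 'C(n, d)%:R * (1 - d%:R / n%:R) ^+ s :> R.
Proof. by move=> n0 dn sd; rewrite bin_small // add0n ler_bin_subn. Qed.

Lemma ler_bin_pow (R : realFieldType) (a n d : nat) : (0 < n)%N -> (a <= n)%N ->
  'C(a, d)%:R <= 'C(n, d)%:R * (a%:R / n%:R) ^+ d :> R.
Proof.
move=> n0 an; rewrite expr_div_n mulrA ler_pdivlMr ?exprn_gt0 ?ltr0n //.
by rewrite -!natrX -!natrM ler_nat leq_bin_pow.
Qed.

(** Square x^d + (1 - x)^d, apply [sqr_sum_pow_le], and use x^2 + (1 - x)^2 = 1 - 2x(1 - x) <=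
    exp(-2x(1 - x)). *)
Lemma noncrossing_ge (R : realType) (n d s : nat) :
  (0 < n)%N -> (2 <= d)%N -> (s <= n)%N ->
  ('C(s, d) + 'C(n - s, d))%:R
  <= 'C(n, d)%:R * expR (- (d%:R * (s%:R / n%:R) * (1 - s%:R / n%:R))) :> R.
Proof.
move=> n0 d2 sn; have nR : 0 < n%:R :> R by rewrite ltr0n.
have snE : (n - s)%:R / n%:R = 1 - s%:R / n%:R :> R.
  by rewrite natrB // mulrBl divff ?gt_eqF.
rewrite natrD (le_trans (lerD (ler_bin_pow _ _ n0 sn)
  (ler_bin_pow _ _ n0 (leq_subr s n)))) //.
rewrite -mulrDr ler_wpM2l // snE.
have x0 : 0 <= s%:R / n%:R :> R by rewrite divr_ge0.
have x1 : 0 <= 1 - s%:R / n%:R :> R by rewrite -snE divr_ge0.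
move: (s%:R / n%:R) x0 x1 => x x0 x1 {sn snE}.
rewrite -ler_sqr ?nnegrE ?expR_ge0 ?addr_ge0 ?exprn_ge0 //.
rewrite (le_trans (sqr_sum_pow_le x0 x1 d2)) // -expRM_natl.
apply: (@le_trans _ _ (expR (- (2 * x * (1 - x))) ^+ d)).
  rewrite lerXn2r ?nnegrE ?expR_ge0 ?addr_ge0 ?sqr_ge0 //.
  by rewrite (le_trans _ (expR_ge1Dx _)) //; lra.
by rewrite -expRM_natl ler_expR; lra.
Qed.

(* With x = s/n and theta = (1 - x)^2, the choice of exponents rests on
   (1 - theta) ln n - ln s <= (1 - theta) ln (n/s) <= 2 x (n/s) = 2. *)
Lemma noncrossing_exponent_le (R : realType) (n m d s : nat) (Q : R) :
  Q = ln n%:R + m%:R * ln (1 - d%:R / n%:R) -> Q <= 0 ->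
  (d < n)%N -> (0 < s)%N -> (d <= s)%N -> (s.*2 <= n)%N ->
  s%:R * (1 + ln n%:R - ln s%:R)
    - m%:R * (d%:R * (s%:R / n%:R) * (1 - s%:R / n%:R))
  <= s%:R * (3 + Q / 4).
Proof.
move=> QE Q0 dn s0 ds s2n.
have n0 : (0 < n)%N by lia.
have nR : 0 < n%:R :> R by rewrite ltr0n.
have sR : 0 < s%:R :> R by rewrite ltr0n.
have -> : d%:R * (s%:R / n%:R) = s%:R * (d%:R / n%:R) :> R by ring.
have yx : d%:R / n%:R <= s%:R / n%:R :> R by rewrite ler_pM2r ?invr_gt0 // ler_nat.
have y0 : 0 <= d%:R / n%:R :> R by rewrite divr_ge0.
have x_half : s%:R / n%:R <= 2^-1 :> R.
  rewrite ler_pdivrMr // mulrC ler_pdivlMr // -natrM ler_nat; lia.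
have lnt : (ln n%:R - ln s%:R) * (s%:R / n%:R) <= 1 :> R.
  rewrite -ln_div ?posrE // -ler_pdivlMr ?divr_gt0 // mul1r invf_div.
  by rewrite ltW // ln_sublinear // divr_gt0.
have lns : 0 <= ln s%:R :> R by rewrite ln_ge0 // ler1n.
have lnn : ln s%:R <= ln n%:R :> R by rewrite ler_ln ?posrE // ler_nat; lia.
rewrite -subr_ge0.
have x0 : 0 < s%:R / n%:R :> R by rewrite divr_gt0.
move: QE yx y0 x_half lnt lns lnn x0.
move: (d%:R / n%:R) (s%:R / n%:R) (ln n%:R) (ln s%:R) => y x a b.
move=> QE yx y0 xh lnt lns lnn x0.
rewrite -mulrA mulrCA -!mulrBr mulr_ge0 ?ler0n //.
have y1 : 0 < 1 - y by lra.
(* This is ln(1 + u) <= u at u = y / (1 - y). *)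
have l1 : - ln (1 - y) * (1 - y) <= y.
  have : ln (1 - y)^-1 <= y / (1 - y).
    have e : (1 - y)^-1 = 1 + y / (1 - y) by field; rewrite gt_eqF.
    rewrite [X in ln X]e.
    by rewrite le_ln1Dx // (lt_le_trans _ (divr_ge0 y0 (ltW y1))) // ltrN10.
  by rewrite lnV ?posrE // ler_pdivlMr.
have l0 : ln (1 - y) <= 0 by rewrite ln_le0 //; lra.
have m0 : 0 <= m%:R :> R by [].
(* Here d <= s enters, as 1 - x <= 1 - y. *)
have l2 : - ln (1 - y) * (1 - x) <= y.
  by rewrite (le_trans _ l1) // ler_wpM2l ?oppr_ge0 //; lra.
have l3 : (a - Q) * (1 - x) <= m%:R * y.
  have -> : a - Q = m%:R * - ln (1 - y) by rewrite QE; ring.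
  by rewrite -mulrA ler_wpM2l.
have l4 : (a - Q) * (1 - x) ^+ 2 <= m%:R * (y * (1 - x)).
  by rewrite expr2 !mulrA ler_wpM2r //; lra.
(* Since x <= 1/2, theta >= 1/4, and Q is nonpositive; this is the source of Q/4. *)
have l5 : (1 - x) ^+ 2 * Q <= Q / 4.
  rewrite mulrC ler_wnM2l //; nra.
have l6 : (1 - (1 - x) ^+ 2) * (a - b) <= 2.
  have : (2 * x) * (a - b) <= 2 by move: lnt; lra.
  apply: le_trans; rewrite ler_wpM2r ?subr_ge0 //; nra.
have l7 : 0 <= (1 - x) ^+ 2 * b by rewrite mulr_ge0 ?sqr_ge0.
lra.
Qed.

(** * The union bound as a geometric series *)

Lemma noncrossing_term_le (R : realType) (n m d s : nat) (Q : R) :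
  Q = ln n%:R + m%:R * ln (1 - d%:R / n%:R) -> Q <= 0 ->
  (2 <= d < n)%N -> (0 < s)%N -> (s.*2 <= n)%N ->
  ('C(n, s) * ('C(s, d) + 'C(n - s, d)) ^ m)%:R
  <= ('C(n, d) ^ m)%:R * expR (3 + Q / 4) ^+ s.
Proof.
move=> QE Q0 /andP[d2 dn] s0 s2n; have n0 : (0 < n)%N by lia.
have nR : 0 < n%:R :> R by rewrite ltr0n.
rewrite natrM !natrX -expRM_natl.
have [sd|ds] := ltnP s d.
  set p : R := 1 - d%:R / n%:R in QE *.
  have p0 : 0 < p by rewrite subr_gt0 ltr_pdivrMr // mul1r ltr_nat.
  have := noncrossing_lt R n0 (ltnW dn) sd; rewrite -/p => h.
  (* For s < d the crude 'C(n, s) <= n^s suffices: the term becomes (n p^m)^s = e^(sQ), and Q <= 3 +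
     Q/4 because Q <= 0. *)
  apply: (@le_trans _ _ (n%:R ^+ s * ('C(n, d)%:R * p ^+ s) ^+ m)).
    apply: ler_pM => //; rewrite ?exprn_ge0 //; last first.
      by rewrite lerXn2r ?nnegrE ?mulr_ge0 ?exprn_ge0 ?(ltW p0).
    rewrite -natrX ler_nat; apply: leq_trans (_ : n ^_ s <= _)%N.
      by rewrite -bin_ffact leq_pmulr // fact_gt0.
    exact: ffact_leq_expn.
  rewrite exprMn mulrCA ler_wpM2l ?exprn_ge0 //.
  rewrite -exprM mulnC exprM -exprMn.
  have -> : n%:R * p ^+ m = expR Q.
    by rewrite QE expRD expRM_natl !lnK ?posrE.
  by rewrite -expRM_natl ler_expR ler_wpM2l //; lra.
have h := noncrossing_ge R n0 d2 (_ : s <= n)%N.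
apply: le_trans (ler_pM _ _ (bin_le_expR R s0 n0) (lerXn2r m _ _ (h _))) _;
  rewrite ?nnegrE ?exprn_ge0 ?mulr_ge0 ?expR_ge0 //; first lia.
rewrite exprMn mulrCA ler_wpM2l ?exprn_ge0 // -expRM_natl -expRD ler_expR.
rewrite mulrN; exact: noncrossing_exponent_le.
Qed.

Lemma geometric_sum_le (R : realFieldType) (r : R) (k : nat) :
  0 <= r -> r <= 2^-1 -> \sum_(s < k.+1 | (0 < s)%N) r ^+ s <= 2 * r.
Proof.
move=> r0 r2; rewrite big_mkcond big_ord_recl /= add0r.
(* The added tail makes the induction close, since r^(k+1) + 2 r^(k+2) <= 2 r^(k+1) for r <= 1/2. *)
suff : \sum_(i < k) r ^+ i.+1 + 2 * r ^+ k.+1 <= 2 * r.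
  by apply: le_trans; rewrite lerDl mulr_ge0 ?exprn_ge0.
elim: k => [|k IHk]; first by rewrite big_ord0 add0r expr1.
rewrite big_ord_recr /= (le_trans _ IHk) // -addrA lerD2l [r ^+ k.+2]exprS.
have := exprn_ge0 k.+1 r0; nra.
Qed.

Lemma prob_connected_ge (R : realType) (n m d : nat) (Q : R) :
  Q = ln n%:R + m%:R * ln (1 - d%:R / n%:R) -> (2 <= d < n)%N ->
  expR (3 + Q / 4) <= 2^-1 ->
  1 - 2 * expR (3 + Q / 4) <= prob_connected R n m d.
Proof.
move=> QE dn r2.
have Q0 : Q <= 0.
  have : expR (3 + Q / 4) <= expR 0.
    by rewrite expR0 (le_trans r2) // invf_le1 ?ler1n.
  by rewrite ler_expR; lra.
rewrite /prob_connected card_hypergraphs.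
set N : R := (_ ^ _)%:R.
have N_gt0 : 0 < N by rewrite ltr0n expn_gt0 bin_gt0; lia.
rewrite ler_pdivlMr // mulrBl mul1r lerBlDr.
have NE : N = #|[set f : {ffun 'I_m -> dsubset n d} | hconnected (hyp_of f)]|%:R
            + #|[set f : {ffun 'I_m -> dsubset n d} | ~~ hconnected (hyp_of f)]|%:R.
  rewrite -natrD /N -card_hypergraphs -(cardsC [set f | hconnected (hyp_of f)]).
  by congr (_ + _)%:R; apply: eq_card => f; rewrite !inE.
rewrite [leLHS]NE lerD2l.
have := disconnected_card_le n m d; rewrite -(ler_nat R) => /le_trans; apply.
rewrite natr_sum [leRHS]mulrC.
apply: le_trans (ler_wpM2l (ltW N_gt0) (geometric_sum_le n./2 (expR_ge0 _) r2)).
rewrite mulr_sumr; apply: ler_sum => s s0; apply: noncrossing_term_le => //.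
have := ltn_ord s; lia.
Qed.

(** * The case d = n, and the two limits *)

Lemma prob_connected_full (R : realType) (n m : nat) : (0 < m)%N ->
  prob_connected R n m n = 1.
Proof.
move=> m0; rewrite /prob_connected.
have card0 : #|{: {ffun 'I_m -> dsubset n n}}|%:R != 0 :> R.
  by rewrite card_hypergraphs binn exp1n oner_eq0.
rewrite -[RHS](divff card0); congr (_%:R / _); apply: eq_card => f.
rewrite !inE; apply/forallP => S; apply/implyP => /andP[S0 SC0].
(* The only n-subset is the whole node set, so any one edge crosses every cut; m >= 1 supplies
   one. *)
apply/existsP; exists (Ordinal m0); rewrite /hyp_of.
have -> : val (f (Ordinal m0)) = [set: 'I_n].
  by apply/eqP; rewrite eqEcard finset.subsetT cardsT card_ord /= (eqP (valP (f _))).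
by rewrite !finset.setTI S0.
Qed.

Local Open Scope classical_set_scope.

Theorem mainTheorem6 (R : realType) (m d : nat -> nat)
  (hmd : forall n : nat, (2 <= n)%N -> (1 <= m n)%N /\ (2 <= d n <= n)%N) :
  ((fun n => conn_quantity R n (m n) (d n)) @ \oo --> +oo%E ->
     (fun n => prob_connected R n (m n) (d n)) @ \oo --> (0 : R)) /\
  ((fun n => conn_quantity R n (m n) (d n)) @ \oo --> -oo%E ->
     (fun n => prob_connected R n (m n) (d n)) @ \oo --> (1 : R)).
Proof.
split=> [/cvgeyPge cq|/cvgeNyPle cq]; apply/cvgrPdist_le => e e0.
  near=> n.
  have n2 : (2 <= n)%N by near: n; exact: nbhs_infty_ge.
  have nR : 0 < n%:R :> R by rewrite ltr0n; lia.
  (* A finite lower bound excludes the value -oo, hence d < n; the threshold - ln e makes the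
     Chebyshev bound 1/mu at most e. *)
  have : ((- ln e)%:E <= conn_quantity R n (m n) (d n))%E by near: n; exact: cq.
  rewrite /conn_quantity; case: ifPn => // dn; rewrite lee_fin => hq.
  rewrite sub0r normrN ger0_norm ?divr_ge0 //.
  apply: le_trans (prob_connected_le R (m n) n2 dn) _.
  have p0 : 0 < 1 - (d n)%:R / n%:R :> R.
    by rewrite subr_gt0 ltr_pdivrMr // mul1r ltr_nat.
  rewrite invf_ple ?posrE ?mulr_gt0 ?exprn_gt0 //.
  rewrite -ler_ln ?posrE ?invr_gt0 ?mulr_gt0 ?exprn_gt0 //.
  rewrite lnV ?posrE // lnM ?posrE ?exprn_gt0 //.
  by rewrite lnXn // -[ln _ *+ m n]mulr_natl.
near=> n.
have n2 : (2 <= n)%N by near: n; exact: nbhs_infty_ge.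
have [m1 /andP[d2 dn]] := hmd n n2.
(* The threshold solves exp(3 + Q/4) = min(e, 1)/2: the 1 keeps the ratio at most 1/2, and the e
   makes twice the ratio at most e. *)
have : (conn_quantity R n (m n) (d n)
        <= (4 * (ln (Num.min e 1 / 2) - 3))%:E)%E by near: n; exact: cq.
have prob_le1 : prob_connected R n (m n) (d n) <= 1.
  rewrite /prob_connected card_hypergraphs ler_pdivrMr ?ltr0n ?expn_gt0 ?bin_gt0 ?dn //.
  by rewrite mul1r ler_nat -card_hypergraphs max_card.
rewrite ger0_norm ?subr_ge0 //.
rewrite /conn_quantity; case: ifPn => [lt_dn|ge_dn] hq; last first.
  (* At d = n the quantity is -oo by convention and carries no information on m, so this case is
     settled directly. *)
  have -> : d n = n by lia.
  by rewrite prob_connected_full // subrr ltW.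
rewrite lee_fin in hq; set Q := (Q in Q <= _) in hq.
have e1 : 0 < Num.min e 1 / 2 :> R by rewrite divr_gt0 ?lt_min ?e0 ?ltr01 ?ltr0n.
have hr : expR (3 + Q / 4) <= Num.min e 1 / 2.
  by rewrite -[leRHS]lnK ?posrE // ler_expR; move: hq; lra.
have me : Num.min e 1 <= e by rewrite ge_min lexx.
have m1' : Num.min e 1 <= 1 :> R by rewrite ge_min lexx orbT.
have r2 : expR (3 + Q / 4) <= 2^-1 by move: hr; lra.
have := prob_connected_ge (erefl Q) (_ : 2 <= d n < n)%N r2.
rewrite d2 lt_dn => /(_ isT); move: hr; lra.
Unshelve. all: by end_near.
Qed.
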